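(* Let $\mathcal{R}$ be a $*$-ring of characteristic 2, let $\mathcal{V}$ be an indefinite inner product module (IIPM) over $\mathcal{R}$, let $T:\mathcal{V}\to\mathcal{V}$ be a self-adjoint morphism, and let $N\ge 1$ be a natural number. Let $U$ be the morphism on $\oplus_{k=1}^{N+1}\mathcal{V}$ given by the $(N+1)\times(N+1)$ operator matrix $$U:=\begin{pmatrix} T & 0 & 0 & \cdots & 0 & 0 & I_{\mathcal{V}}+T\\ I_{\mathcal{V}}+T & 0 & 0 & \cdots & 0 & 0 & T\\ 0 & I_{\mathcal{V}} & 0 & \cdots & 0 & 0 & 0\\ 0 & 0 & I_{\mathcal{V}} & \cdots & 0 & 0 & 0\\ \vdots & \vdots & \vdots & & \vdots & \vdots & \vdots\\ 0 & 0 & 0 & \cdots & 0 & 0 & 0\\ 0 & 0 & 0 & \cdots & I_{\mathcal{V}} & 0 & 0\\ 0 & 0 & 0 & \cdots & 0 & I_{\mathcal{V}} & 0 \end{pmatrix},$$ that is, the $(1,1)$ entry is $T$, the $(1,N+1)$ entry is $I_{\mathcal{V}}+T$, the $(2,1)$ entry is $I_{\mathcal{V}}+T$, the $(2,N+1)$ entry is $T$, the $(j,j-1)$ entry is $I_{\mathcal{V}}$ for $3\le j\le N+1$, and all other entries are $0$. Then $U$ is unitary on $\oplus_{k=1}^{N+1}\mathcal{V}$ and $$T^k=P_{\mathcal{V}}U^k|_{\mathcal{V}}\quad\text{and}\quad (T^* )^k=P_{\mathcal{V}}(U^* )^k|_{\mathcal{V}}\qquad\text{for all } k=1,\dots,N,$$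 where $P_{\mathcal{V}}:\oplus_{k=1}^{N+1}\mathcal{V}\to\mathcal{V}$, $(x_k)_{k=1}^{N+1}\mapsto x_1$, and $|_{\mathcal{V}}$ denotes restriction to the first summand, i.e. to $\mathcal{V}\cong\{(x,0,\dots,0):x\in\mathcal{V}\}$.
   Context: A $*$-ring is a ring $\mathcal{R}$ with an automorphism $*$ which is either the identity or of order 2. Characteristic 2 means $r+r=0$ for all $r\in\mathcal{R}$. A module $\mathcal{V}$ over $\mathcal{R}$ is an indefinite inner product module (IIPM) if it is equipped with a map $\langle\cdot,\cdot\rangle:\mathcal{V}\times\mathcal{V}\to\mathcal{R}$ such that: (i) if $x\in\mathcal{V}$ satisfies $\langle x,y\rangle=0$ for all $y\in\mathcal{V}$, then $x=0$; (ii) $\langle x,y\rangle=\langle y,x\rangle^*$ for all $x,y\in\mathcal{V}$; (iii) $\langle ax+y,z\rangle=a\langle x,z\rangle+\langle y,z\rangle$ for all $a\in\mathcal{R}$ and $x,y,z\in\mathcal{V}$. A morphism is an $\mathcal{R}$-module homomorphism; $I_{\mathcal{V}}$ is the identity on $\mathcal{V}$. A morphism $T:\mathcal{V}\to\mathcal{V}$ is adjointable if there is a morphism $T^*:\mathcal{V}\to\mathcal{V}$ with $\langle Tx,y\rangle=\langle x,T^*y\rangle$ for all $x,y\in\mathcal{V}$ (by (i), $T^*$ is unique if it exists). An adjointable morphism $T$ is self-adjoint if $T^*=T$. An adjointable morphism $U$ on an IIPM $\mathcal{W}$ is unitary if $UU^*=U^*U=I_{\mathcal{W}}$. The direct sum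 $\oplus_{k=1}^{N+1}\mathcal{V}$ is the IIPM with inner product $\langle(x_k)_k,(y_k)_k\rangle=\sum_{k=1}^{N+1}\langle x_k,y_k\rangle$. Operator matrices act on column vectors in the usual way. *)

(* Defs.v *)
From HB Require Import structures.
From mathcomp Require Import all_boot all_order all_algebra.
Set Implicit Arguments.
Unset Strict Implicit.
Unset Printing Implicit Defensive.
Import GRing.Theory.
Local Open Scope ring_scope.

(* "The identity or of order 2" is [involutive], which also makes the ring
   morphism [star] bijective.  The ring need not be commutative, and [star] is
   multiplicative (an automorphism), not anti-multiplicative. *)
HB.mixin Record isStarRing R of GRing.PzRing R := {
  star : {rmorphism R -> R};
  starK : involutive star
}.

#[short(type="starRingType")]
HB.structure Definition StarRing := {R of isStarRing R & GRing.PzRing R}.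

HB.mixin Record isIIPM (R : starRingType) V of GRing.Lmodule R V := {
  inner : V -> V -> R;
  inner_nondegenerate : forall x : V, (forall y, inner x y = 0) -> x = 0;
  inner_star : forall x y : V, inner x y = star (inner y x);
  innerPl : forall (a : R) (x y z : V),
    inner (a *: x + y) z = a * inner x z + inner y z
}.

#[short(type="iipmType")]
HB.structure Definition IIPM (R : starRingType) :=
  {V of isIIPM R V & GRing.Lmodule R V}.

Section DirectSum.
Variables (R : starRingType) (V : iipmType R) (I : finType).

Definition dsum_inner (x y : {ffun I -> V}) : R := \sum_i inner (x i) (y i).

Lemma inner0l (z : V) : inner 0 z = 0.
Proof.
have := innerPl 1 0 0 z; rewrite scaler0 addr0 mul1r => e.
by apply: (addrI (inner 0 z)); rewrite addr0 -e.
Qed.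

Lemma inner0r (z : V) : inner z 0 = 0.
Proof. by rewrite inner_star inner0l rmorph0. Qed.

Fact dsum_inner_nondegenerate (x : {ffun I -> V}) :
  (forall y, dsum_inner x y = 0) -> x = 0.
Proof.
move=> x0; apply/ffunP => i; rewrite ffunE; apply: inner_nondegenerate => v.
rewrite -(x0 [ffun j => if j == i then v else 0]) /dsum_inner (bigD1 i) //=.
rewrite ffunE eqxx big1 ?addr0 // => j /negPf ji.
by rewrite ffunE ji inner0r.
Qed.

Fact dsum_inner_star (x y : {ffun I -> V}) :
  dsum_inner x y = star (dsum_inner y x).
Proof. by rewrite rmorph_sum; apply: eq_bigr => i _; exact: inner_star. Qed.

Fact dsum_innerPl (a : R) (x y z : {ffun I -> V}) :
  dsum_inner (a *: x + y) z = a * dsum_inner x z + dsum_inner y z.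
Proof.
rewrite mulr_sumr -big_split; apply: eq_bigr => i _ /=.
by rewrite !ffunE innerPl.
Qed.

HB.instance Definition _ := isIIPM.Build R {ffun I -> V}
  dsum_inner_nondegenerate dsum_inner_star dsum_innerPl.

End DirectSum.

Section Operators.
Variables (R : starRingType) (W : iipmType R).
Implicit Types S T U : {linear W -> W}.

(* [is_adjoint T S] reads "T is adjointable and T^* = S"; see [adjoint_unique]. *)
Definition is_adjoint T S : Prop :=
  forall x y : W, inner (T x) y = inner x (S y).

Lemma adjoint_unique T S1 S2 : is_adjoint T S1 -> is_adjoint T S2 -> S1 =1 S2.
Proof.
move=> h1 h2 y; apply/eqP; rewrite -subr_eq0; apply/eqP.
apply: inner_nondegenerate => x; rewrite addrC -scaleN1r innerPl mulN1r.
by rewrite (inner_star (S1 y)) (inner_star (S2 y)) -h1 -h2 addNr.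
Qed.

Definition self_adjoint T : Prop := is_adjoint T T.

Definition unitary U : Prop :=
  exists Us : {linear W -> W},
    [/\ is_adjoint U Us, U \o Us =1 idfun & Us \o U =1 idfun].

End Operators.

Section OperatorMatrix.
Variables (R : pzRingType) (V : lmodType R) (m n : nat).

Definition opmx (A : 'I_m -> 'I_n -> {linear V -> V}) (x : {ffun 'I_n -> V}) :
    {ffun 'I_m -> V} :=
  [ffun i => \sum_(j < n) A i j (x j)].

Fact opmx_linear A : linear (opmx A).
Proof.
move=> a x y; apply/ffunP => i; rewrite !ffunE scaler_sumr -big_split /=.
by apply: eq_bigr => j _; rewrite !ffunE linearP.
Qed.

HB.instance Definition _ A :=
  GRing.isLinear.Build R {ffun 'I_n -> V} {ffun 'I_m -> V} *:%R (opmx A)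
    (opmx_linear A).

End OperatorMatrix.

Section Dilation.
Variables (R : pzRingType) (V : lmodType R) (N : nat).

(* Rows and columns are numbered from 0, so the last column is N. *)
Definition dilation_entry (T : {linear V -> V}) (i j : 'I_N.+1) :
    {linear V -> V} :=
  let O : {linear V -> V} := \0 in
  let I : {linear V -> V} := idfun in
  let IT : {linear V -> V} := idfun \+ T in
  if i == 0%N :> nat then
    if j == 0%N :> nat then T else if j == N :> nat then IT else O
  else if i == 1%N :> nat then
    if j == 0%N :> nat then IT else if j == N :> nat then T else O
  else if i == j.+1 :> nat then I else O.

Definition dilation (T : {linear V -> V}) :
    {linear {ffun 'I_N.+1 -> V} -> {ffun 'I_N.+1 -> V}} :=
  opmx (dilation_entry T).

Definition first_proj (x : {ffun 'I_N.+1 -> V}) : V := x ord0.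

Definition first_inj (x : V) : {ffun 'I_N.+1 -> V} :=
  [ffun i => if i == ord0 then x else 0].

End Dilation.

(* Main.v *)
(* On the first and last input coordinates and the first two output
   coordinates, U acts by the block (u, v) |-> (s + v, s + u) with
   s = T (u + v); the other coordinates are shifted down.  In characteristic 2
   this block preserves u + v, hence it is its own inverse, and since T is
   self-adjoint the transposed matrix is both the adjoint and the inverse of U.
   A vector (x, 0, ..., 0) needs N steps of the shift to
   reach the last coordinate, so until then the first coordinate is only
   multiplied by T.  The statement about adjoint powers follows by duality,
   because P_V is the adjoint of the inclusion of V. *)
Require Import Defs.
From HB Require Import structures.
From mathcomp Require Import all_boot all_order all_algebra.
Set Implicit Arguments.
Unset Strict Implicit.
Unset Printing Implicit Defensive.
Import GRing.Theory.
Local Open Scope ring_scope.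

Lemma big_two (V : nmodType) (I : finType) (a b : I) (F : I -> V) :
  a != b -> (forall i, i != a -> i != b -> F i = 0) -> \sum_i F i = F a + F b.
Proof.
move=> ab F0; rewrite (bigD1 a) //= (bigD1 b) 1?eq_sym //= big1 ?addr0 //.
by move=> i /andP[]; exact: F0.
Qed.

Lemma big_one (V : nmodType) (I : finType) (a : I) (F : I -> V) :
  (forall i, i != a -> F i = 0) -> \sum_i F i = F a.
Proof. by move=> F0; rewrite (bigD1 a) //= big1 ?addr0. Qed.

Section Inner.
Variables (R : starRingType) (W : iipmType R).

Lemma innerDl (x y z : W) : inner (x + y) z = inner x z + inner y z.
Proof. by rewrite -{1}(scale1r x) innerPl mul1r. Qed.

Lemma innerDr (x y z : W) : inner x (y + z) = inner x y + inner x z.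
Proof. by rewrite !(inner_star x) innerDl rmorphD. Qed.

Lemma inner_suml (I : finType) (F : I -> W) (z : W) :
  inner (\sum_i F i) z = \sum_i inner (F i) z.
Proof.
by apply: (big_morph (fun x => inner x z)) => [x y|]; rewrite ?innerDl ?inner0l.
Qed.

Lemma inner_sumr (I : finType) (F : I -> W) (z : W) :
  inner z (\sum_i F i) = \sum_i inner z (F i).
Proof.
by apply: (big_morph (inner z)) => [x y|]; rewrite ?innerDr ?inner0r.
Qed.

Lemma inner_inj (x y : W) : (forall z, inner x z = inner y z) -> x = y.
Proof.
move=> xy; apply/eqP; rewrite -subr_eq0; apply/eqP.
apply: inner_nondegenerate => z.
by rewrite addrC -scaleN1r innerPl mulN1r xy addNr.
Qed.

Lemma is_adjointC (S T : {linear W -> W}) : is_adjoint S T -> is_adjoint T S.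
Proof. by move=> h x y; rewrite inner_star -h -inner_star. Qed.

Lemma is_adjoint_iter (S T : {linear W -> W}) k (x y : W) :
  is_adjoint S T -> inner (iter k S x) y = inner x (iter k T y).
Proof. by move=> h; elim: k y => //= k IH y; rewrite h IH -iterS iterSr. Qed.

End Inner.

Lemma is_adjoint_opmx (R : starRingType) (V : iipmType R) n
    (A B : 'I_n -> 'I_n -> {linear V -> V}) :
  (forall i j, is_adjoint (A i j) (B j i)) -> is_adjoint (opmx A) (opmx B).
Proof.
move=> AB x y.
transitivity (\sum_i \sum_j inner (x j) (B j i (y i))).
  apply: eq_bigr => i _; rewrite ffunE inner_suml.
  by apply: eq_bigr => j _; rewrite AB.
rewrite exchange_big /=; apply: eq_bigr => j _.
by rewrite ffunE inner_sumr.
Qed.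

Lemma inner_first_proj (R : starRingType) (V : iipmType R) N
    (x : {ffun 'I_N.+1 -> V}) (y : V) :
  inner (first_proj x) y = inner x (first_inj N y).
Proof.
rewrite [RHS](big_one (a := ord0)) ?ffunE // => i /negPf i0.
by rewrite ffunE i0 inner0r.
Qed.

Section Coordinates.
Variables (R : pzRingType) (V : lmodType R) (N : nat) (T : {linear V -> V}).
Hypothesis hN : (1 <= N)%N.
Implicit Types x y : {ffun 'I_N.+1 -> V}.

(** The entries are transposed but not replaced by adjoints, so a plain module suffices here; for
    self-adjoint [T] this is the adjoint of [dilation N T]. *)
Definition dilation_tr : {linear {ffun 'I_N.+1 -> V} -> {ffun 'I_N.+1 -> V}} :=
  opmx (fun i j => dilation_entry T j i).

(** By [hN], [inord] does not fall back to its default [ord0]. For N = 1 this index equals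
    [ord_max], so the two are never assumed distinct. *)
Let i1 : 'I_N.+1 := inord 1.

Let i1E : i1 = 1%N :> nat. Proof. by rewrite inordK. Qed.

Let N0 : (N == 0)%N = false. Proof. by case: N hN. Qed.

Let ord0_max : ord0 != ord_max :> 'I_N.+1.
Proof. by rewrite -val_eqE /= eq_sym N0. Qed.

Let ord0_i1 : ord0 != i1. Proof. by rewrite -val_eqE /= i1E. Qed.

(** The entries T and I + T are regrouped so that [T] acts once, on a sum that the first two rows
    share. *)
Lemma dilation_first x :
  dilation N T x ord0 = T (x ord0 + x ord_max) + x ord_max.
Proof.
rewrite ffunE (big_two ord0_max) => [|j]; rewrite /dilation_entry /=.
  by rewrite N0 eqxx linearD /= -addrA [_ + T _]addrC.
by rewrite -!val_eqE /= => /negPf -> /negPf ->.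
Qed.

Lemma dilation_second x :
  dilation N T x i1 = T (x ord0 + x ord_max) + x ord0.
Proof.
rewrite ffunE (big_two ord0_max) => [|j]; rewrite /dilation_entry i1E /=.
  by rewrite N0 eqxx linearD /= -addrA addrC.
by rewrite -!val_eqE /= => /negPf -> /negPf ->.
Qed.

Lemma dilation_shift x (i j : 'I_N.+1) :
  (0 < j)%N -> i = j.+1 :> nat -> dilation N T x i = x j.
Proof.
move=> j0 ij.
have [z o] : (i == 0 :> nat)%N = false /\ (i == 1 :> nat)%N = false.
  by rewrite ij; case: (nat_of_ord j) j0.
rewrite ffunE (big_one (a := j)) /dilation_entry z o ?ij ?eqxx // => l.
by rewrite eqSS eq_sym -val_eqE => /negPf ->.
Qed.

Lemma dilation_tr_first y :
  dilation_tr y ord0 = T (y ord0 + y i1) + y i1.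
Proof.
rewrite ffunE (big_two ord0_i1) => [|j]; rewrite /dilation_entry ?i1E /=.
  by rewrite linearD /= -addrA [_ + T _]addrC.
by rewrite -!val_eqE /= i1E => /negPf -> /negPf ->.
Qed.

Lemma dilation_tr_last y :
  dilation_tr y ord_max = T (y ord0 + y i1) + y ord0.
Proof.
rewrite ffunE (big_two ord0_i1) => [|j]; rewrite /dilation_entry ?i1E /=.
  by rewrite N0 eqxx linearD /= -addrA addrC.
(* From the third row on, an identity in column N would need row index N + 1, which is out of
   range. *)
by rewrite -!val_eqE /= i1E => /negPf -> /negPf ->; rewrite ltn_eqF.
Qed.

Lemma dilation_tr_shift y (i j : 'I_N.+1) :
  (0 < j)%N -> i = j.+1 :> nat -> dilation_tr y j = y i.
Proof.
move=> j0 ij; have jN : (j == N :> nat) = false.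
  by rewrite ltn_eqF // -ltnS -ij.
have z : (j == 0 :> nat)%N = false by case: (nat_of_ord j) j0.
rewrite ffunE (big_one (a := i)) /dilation_entry z jN.
  by rewrite ij eqSS z eqxx.
move=> l; rewrite -val_eqE /= -ij => /negPf ->.
by do 2?case: ifP.
Qed.

(** The second conjunct strengthens the induction: at each step k < N the last coordinate is still
    zero, so it adds nothing to the first one. *)
Lemma iter_dilation_first_inj k (x : V) : (k <= N)%N ->
  iter k (dilation N T) (first_inj N x) ord0 = iter k T x /\
  forall i : 'I_N.+1, (k < i)%N ->
    iter k (dilation N T) (first_inj N x) i = 0.
Proof.
elim: k => [_|k IH kN] /=.
  split=> [|i i0]; rewrite ffunE ?eqxx //.
  by rewrite -val_eqE /= gtn_eqF.
have [IH0 IHi] := IH (ltnW kN); split.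
  by rewrite dilation_first IH0 (IHi ord_max) // !addr0.
(* Row i >= 2 copies coordinate i - 1 > k, which vanishes by induction. *)
move=> i ki; have i0 : (0 < i)%N by apply: leq_trans ki.
have jlt : (i.-1 < N.+1)%N by apply: leq_ltn_trans (leq_pred i) _.
have kj : (k < i.-1)%N by rewrite -ltnS prednK.
rewrite (dilation_shift _ (j := Ordinal jlt)) /= ?prednK //.
  exact: IHi.
exact: leq_trans kj.
Qed.

Hypothesis char2 : forall v : V, v + v = 0.

Let cancel_block (s u v : V) : (s + u) + (s + v) = u + v.
Proof. by rewrite addrACA char2 add0r. Qed.

Let addKK (s u : V) : s + (s + u) = u.
Proof. by rewrite addrA char2 add0r. Qed.

Lemma dilation_trK : cancel dilation_tr (dilation N T).
Proof.
move=> y; apply/ffunP => i; case: (posnP i) => [i0|].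
  have -> : i = ord0 by apply: val_inj.
  rewrite dilation_first dilation_tr_first dilation_tr_last.
  (* Now [T] has the same argument in both factors, and its two equal values cancel. *)
  by rewrite cancel_block [y i1 + _]addrC addKK.
rewrite leq_eqVlt => /orP[/eqP i_1|i_2].
  have -> : i = i1 by apply: val_inj; rewrite /= i1E.
  rewrite dilation_second dilation_tr_first dilation_tr_last.
  by rewrite cancel_block [y i1 + _]addrC addKK.
have i0 := ltnW i_2.
have jlt : (i.-1 < N.+1)%N by apply: leq_ltn_trans (leq_pred i) _.
have j0 : (0 < i.-1)%N by rewrite -ltnS prednK.
rewrite (dilation_shift _ (j := Ordinal jlt)) ?(dilation_tr_shift _ (i := i));
  by rewrite /= ?prednK.
Qed.

Lemma dilationK : cancel (dilation N T) dilation_tr.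
Proof.
move=> x; apply/ffunP => j; case: (posnP j) => [j0|j0].
  have -> : j = ord0 by apply: val_inj.
  rewrite dilation_tr_first dilation_first dilation_second.
  by rewrite cancel_block [x ord_max + _]addrC addKK.
(* Outputs of the transpose follow the columns of U: those strictly between 0 and N are shifts,
   while column N belongs to the block. *)
case: (ltnP j N) => [jN|Nj].
  have ilt : (j.+1 < N.+1)%N by [].
  rewrite (dilation_tr_shift _ (i := Ordinal ilt)) //.
  by rewrite (dilation_shift _ (j := j)).
have -> : j = ord_max.
  by apply: val_inj; apply/eqP; rewrite eqn_leq Nj -ltnS ltn_ord.
rewrite dilation_tr_last dilation_first dilation_second.
by rewrite cancel_block [x ord_max + _]addrC addKK.
Qed.

End Coordinates.

(** Each entry is 0, I, T or I + T. *)
Lemma self_adjoint_dilation_entry (R : starRingType) (V : iipmType R) N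
    (T : {linear V -> V}) (i j : 'I_N.+1) :
  self_adjoint T -> self_adjoint (dilation_entry T i j).
Proof.
move=> hT x y; rewrite /dilation_entry; do 4?case: ifP => _ //=;
  by rewrite ?innerDl ?innerDr ?hT ?inner0l ?inner0r.
Qed.

Theorem theorem2p3 (R : starRingType) (char2 : forall r : R, r + r = 0)
    (V : iipmType R) (T : {linear V -> V}) (hT : self_adjoint T)
    (N : nat) (hN : (1 <= N)%N) :
  let U : {linear {ffun 'I_N.+1 -> V} -> {ffun 'I_N.+1 -> V}} :=
    dilation N T in
  [/\ unitary U,
      forall k : nat, (1 <= k <= N)%N ->
        iter k T =1 @first_proj R V N \o iter k U \o @first_inj R V N
    & forall (Ts : {linear V -> V})
             (Us : {linear {ffun 'I_N.+1 -> V} -> {ffun 'I_N.+1 -> V}}),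
        is_adjoint T Ts -> is_adjoint U Us ->
        forall k : nat, (1 <= k <= N)%N ->
        iter k Ts =1 @first_proj R V N \o iter k Us \o @first_inj R V N].
Proof.
move=> U.
have char2V (v : V) : v + v = 0.
  by rewrite -(scale1r v) -scalerDl char2 scale0r.
have powU k : (1 <= k <= N)%N ->
    iter k T =1 @first_proj R V N \o iter k U \o @first_inj R V N.
  by case/andP=> _ kN x; have [<-] := iter_dilation_first_inj T hN x kN.
split=> // [|Ts Us TTs UUs k kN x].
  exists (dilation_tr N T); split.
  - by apply: is_adjoint_opmx => i j; apply: self_adjoint_dilation_entry.
  - exact: dilation_trK.
  - exact: dilationK.
(* Paired with y, both sides have their powers moved across the inner product, which leaves [powU]
   at y; this works for any adjoints [Ts] and [Us]. *)
apply: inner_inj => y /=.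
rewrite inner_first_proj (is_adjoint_iter _ _ _ (is_adjointC TTs)).
rewrite (is_adjoint_iter _ _ _ (is_adjointC UUs)) powU //=.
by rewrite inner_star inner_first_proj -inner_star.
Qed.
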